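(* Let $n$ be a non-negative integer. If $\{(s_k),(\sigma_k)\}$ and $\{(t_k),(\tau_k)\}$, $k=0,1,2,\ldots$, are binomial-transform pairs of the first kind, then \[ \sum_{k=0}^n (-1)^{n-k}\binom{n}{k} s_k\, t_{n-k} = \sum_{k=0}^n (-1)^k \binom{n}{k}\sigma_k\, \tau_{n-k}. \]
   Context: Two sequences $(s_k)_{k\ge0}$ and $(\sigma_k)_{k\ge0}$ of complex numbers form a binomial-transform pair of the first kind if $\sigma_n=\sum_{k=0}^n(-1)^k\binom nk s_k$ for every non-negative integer $n$ (equivalently, $s_n=\sum_{k=0}^n(-1)^k\binom nk\sigma_k$ for every $n\ge 0$). *)

(* Defs.v *)
From mathcomp Require Export all_boot all_order all_algebra.
From mathcomp Require Export reals complex.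

Set Implicit Arguments.
Unset Strict Implicit.
Unset Printing Implicit Defensive.

Import GRing.Theory.
Local Open Scope ring_scope.

(* Binomial-transform pair of the first kind; R[i] is the field of complex
   numbers over the real numbers R. *)
Definition binomial_pair1 (R : realType) (s sigma : nat -> R[i]) : Prop :=
  forall n : nat, sigma n = \sum_(0 <= k < n.+1) (-1) ^+ k * 'C(n, k)%:R * s k.

(* Main.v *)
(** Umbrally, with s_k = S^k and t_k = T^k, the dual sequences are (1 - S)^k and
    (1 - T)^k, and both sides equal (S - T)^n = ((1 - T) - (1 - S))^n. This
    becomes an induction on n by means of the shift (E u)_k = u_(k+1): the
    signed convolution F satisfies F(a, b, n+1) = F(a, E b, n) - F(E a, b, n),
    and E s is paired with sigma - E sigma. *)
Require Import Defs.
From mathcomp Require Import all_boot all_order all_algebra.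
From mathcomp Require Import reals complex.

Set Implicit Arguments.
Unset Strict Implicit.
Unset Printing Implicit Defensive.

Import GRing.Theory.
Local Open Scope ring_scope.

Section BinomialConvolution.
Variable A : comPzRingType.
Implicit Types a b : nat -> A.

Definition binomial_conv a b n : A :=
  \sum_(0 <= k < n.+1) (-1) ^+ k * 'C(n, k)%:R * a k * b (n - k)%N.

(** Pascal's rule: for k >= 1 the part C(n, k) gives the first convolution, while C(n, k-1), after k
    is lowered by one, gives the second with its sign flipped. *)
Lemma binomial_convS a b n :
  binomial_conv a b n.+1 =
  binomial_conv a (fun k => b k.+1) n - binomial_conv (fun k => a k.+1) b n.
Proof.
(* The extra term k = n+1 vanishes because C(n, n+1) = 0; both sums then have equal length and share
   their k = 0 term. *)
have -> : binomial_conv a (fun k => b k.+1) n =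
    \sum_(0 <= k < n.+2) (-1) ^+ k * 'C(n, k)%:R * a k * b (n.+1 - k)%N.
  rewrite big_nat_recr //= bin_small // mulr0 !mul0r addr0.
  by apply: eq_big_nat => k /andP[_ lekn]; rewrite subSn.
rewrite /binomial_conv !(big_nat_recl n.+1) //= !bin0 -addrA; congr (_ + _).
rewrite -sumrB; apply: eq_bigr => k _.
by rewrite binS natrD subSS mulrDr !mulrDl exprS mulN1r !mulNr.
Qed.

Lemma binomial_convBl a a' b n :
  binomial_conv (fun k => a k - a' k) b n =
  binomial_conv a b n - binomial_conv a' b n.
Proof. by rewrite -sumrB; apply: eq_bigr => k _; rewrite mulrBr mulrBl. Qed.

Lemma binomial_convBr a b b' n :
  binomial_conv a (fun k => b k - b' k) n =
  binomial_conv a b n - binomial_conv a b' n.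
Proof. by rewrite -sumrB; apply: eq_bigr => k _; rewrite mulrBr. Qed.

(** Reversing k to n - k moves the sign onto the index of [b], hence the swapped arguments. *)
Lemma binomial_conv_rev a b n :
  \sum_(0 <= k < n.+1) (-1) ^+ (n - k) * 'C(n, k)%:R * a k * b (n - k)%N =
  binomial_conv b a n.
Proof.
rewrite /binomial_conv big_nat_rev add0n; apply: eq_big_nat => k /andP[_ lekn].
by rewrite subSS subKn // bin_sub // mulrAC.
Qed.

End BinomialConvolution.

Lemma binomial_pair1E (R : realType) (s sigma : nat -> R[i]) :
  binomial_pair1 s sigma <-> forall n, sigma n = binomial_conv s (fun=> 1) n.
Proof.
by split=> h n; rewrite h; apply: eq_bigr => k _; rewrite mulr1.
Qed.

(** The constant sequence 1 is its own shift, so [binomial_convS] reads sigma_(n+1) = sigma_n -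
    [binomial_conv] (E s) 1 n. *)
Lemma binomial_pair1_shift (R : realType) (s sigma : nat -> R[i]) :
  binomial_pair1 s sigma ->
  binomial_pair1 (fun k => s k.+1) (fun k => sigma k - sigma k.+1).
Proof.
move=> /binomial_pair1E h; apply/binomial_pair1E => n.
by rewrite !h binomial_convS opprB addrC subrK.
Qed.

Lemma binomial_pair1_conv (R : realType) (n : nat) (s sigma t tau : nat -> R[i]) :
  binomial_pair1 s sigma -> binomial_pair1 t tau ->
  binomial_conv t s n = binomial_conv sigma tau n.
Proof.
(* All four sequences are generalized, since the induction hypothesis is applied to shifted
   pairs. *)
elim: n s sigma t tau => [|n IHn] s sigma t tau hs ht.
  by rewrite /binomial_conv !big_nat1 hs ht !big_nat1 !bin0 !mul1r mulrC.
rewrite !binomial_convS (IHn _ _ _ _ (binomial_pair1_shift hs) ht).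
rewrite (IHn _ _ _ _ hs (binomial_pair1_shift ht)).
(* Both differences contribute [binomial_conv sigma tau n], with opposite signs; what survives is
   the recurrence for sigma and tau. *)
by rewrite binomial_convBl binomial_convBr opprB addrC addrA subrK.
Qed.

Theorem theorem1 (R : realType) (n : nat) (s sigma t tau : nat -> R[i])
    (hs : binomial_pair1 s sigma) (ht : binomial_pair1 t tau) :
  \sum_(0 <= k < n.+1) (-1) ^+ (n - k) * 'C(n, k)%:R * s k * t (n - k)%N =
  \sum_(0 <= k < n.+1) (-1) ^+ k * 'C(n, k)%:R * sigma k * tau (n - k)%N.
Proof. by rewrite binomial_conv_rev; apply: binomial_pair1_conv. Qed.
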